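(* Let $X$ be a pointed metric space and $E$ a Banach space over $\mathbb{K}$. The map $J\colon X\boxtimes_{\varepsilon} E\to\mathcal{F}((X^\#,\tau_p);E)$, defined by $$J(u)(g)=\sum_{i=1}^n\left(g(x_i)-g(y_i)\right)e_i$$ for $u=\sum_{i=1}^n \delta_{(x_i,y_i)}\boxtimes e_i\in X\boxtimes E$ and $g\in X^\#$, is an isometric isomorphism. As a consequence, $X\widehat{\boxtimes}_{\varepsilon} E$ is isometrically isomorphic to the closure in the operator norm topology of $\mathcal{F}((X^\#,\tau_p);E)$.
   Context: $\mathbb{K}$ is $\mathbb{R}$ or $\mathbb{C}$. A pointed metric space $X$ is a metric space with a distinguished base point $0$. For a pointed metric space $X$ and a Banach space $F$, $\mathrm{Lip}_0(X,F)$ is the Banach space of all Lipschitz maps $f\colon X\to F$ with $f(0)=0$, normed by the least Lipschitz constant $\mathrm{Lip}(f)$; $X^\#=\mathrm{Lip}_0(X,\mathbb{K})$. $B_Z$ denotes the closed unit ball of a normed space $Z$. $E^*$ is the topological dual of $E$ and $\langle\phi,e\rangle=\phi(e)$; $V'$ denotes the algebraic dual of a vector space $V$. For $x,y\in X$ and $e\in E$, $\delta_{(x,y)}\boxtimes e\in \mathrm{Lip}_0(X,E^* )'$ is the linear functional $f\mapsto\langle f(x)-f(y),e\rangle$. The Lipschitz tensor product $X\boxtimes E$ is the linear subspace of $\mathrm{Lip}_0(X,E^* )'$ spanned by all the functionals $\delta_{(x,y)}\boxtimes e$ with $x,y\in X$, $e\in E$. Every $u\in X\boxtimes E$ can be written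 (non-uniquely) as $u=\sum_{i=1}^n\delta_{(x_i,y_i)}\boxtimes e_i$. The Lipschitz injective norm on $X\boxtimes E$ is, for $u=\sum_{i=1}^n \delta_{(x_i,y_i)}\boxtimes e_i$ (independently of the representation), $$\varepsilon(u)=\sup\left\{\left|\sum_{i=1}^n(g(x_i)-g(y_i))\langle\phi,e_i\rangle\right|\colon g\in B_{X^\#},\ \phi\in B_{E^*}\right\}.$$ $X\boxtimes_\varepsilon E$ is $X\boxtimes E$ with the norm $\varepsilon$, and $X\widehat{\boxtimes}_{\varepsilon}E$ is its completion. $\tau_p$ is the topology of pointwise convergence (on $X$) on $X^\#$. $\mathcal{F}((X^\#,\tau_p);E)$ is the vector space of all finite-rank linear operators $S\colon X^\#\to E$ that are continuous from $\tau_p$ to the norm topology of $E$, equipped with the operator norm $\|S\|=\sup\{\|S(g)\|\colon g\in B_{X^\#}\}$; the closure is taken in the Banach space of bounded linear operators from $(X^\#,\mathrm{Lip})$ to $E$. *)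

(* Defs.v *)
From HB Require Import structures.
From mathcomp Require Import all_boot all_order all_algebra.
From mathcomp Require Import all_classical all_reals topology normedtype.
From mathcomp.real_closed Require Import complex.

Set Implicit Arguments.
Unset Strict Implicit.
Unset Printing Implicit Defensive.

Import Order.TTheory GRing.Theory Num.Theory.
Import numFieldNormedType.Exports.
Local Open Scope classical_set_scope.
Local Open Scope ring_scope.

Variant scalar_kind := real_scalars | complex_scalars.

Definition scalar_field (R : realType) (s : scalar_kind) : numFieldType :=
  match s with
  | real_scalars => R
  | complex_scalars => R[i]
  end.

(* Norms over a [numFieldType] K take their values in K, also for K = R[i].
   [to_real] and [of_real] move (real) norms between K and R, where suprema
   and infima are available. *)
Section scalar_field.
Context {R : realType} {s : scalar_kind}.

Definition to_real : scalar_field R s -> R :=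
  match s return scalar_field R s -> R with
  | real_scalars => id
  | complex_scalars => @complex.Re R
  end.

Definition of_real : R -> scalar_field R s :=
  match s return R -> scalar_field R s with
  | real_scalars => id
  | complex_scalars => @real_complex_def R (Phant R)
  end.

Lemma of_realK : cancel of_real to_real.
Proof. by rewrite /of_real /to_real; case: s. Qed.

Lemma to_realK (x : scalar_field R s) : 0 <= x -> of_real (to_real x) = x.
Proof.
rewrite /of_real /to_real; case: s x => //= -[a b].
by rewrite lecE /= => /andP[/eqP ->].
Qed.

Lemma of_realD : {morph of_real : x y / x + y}.
Proof.
by move=> x y; rewrite /of_real; case: s => //=; rewrite -[LHS]/((x + y)%:C)%C rmorphD.
Qed.

Lemma of_realM : {morph of_real : x y / x * y}.
Proof.
by move=> x y; rewrite /of_real; case: s => //=; rewrite -[LHS]/((x * y)%:C)%C rmorphM.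
Qed.

Lemma ler_of_real x y : (of_real x <= of_real y) = (x <= y).
Proof. by rewrite /of_real; case: s => //=; rewrite lecE /= eqxx. Qed.

Lemma of_real0 : of_real 0 = 0.
Proof. by rewrite /of_real; case: s. Qed.

Lemma of_real1 : of_real 1 = 1.
Proof. by rewrite /of_real; case: s. Qed.

Lemma of_real_ge0 x : (0 <= of_real x) = (0 <= x).
Proof. by rewrite -of_real0 ler_of_real. Qed.

Lemma norm_of_real x : `|of_real x| = of_real `|x|.
Proof.
rewrite /of_real; case: s => //=.
by rewrite -[X in `|X|]/((x%:C)%C) normc_def /= expr0n /= addr0 sqrtr_sqr.
Qed.

Lemma ler_to_real (x y : scalar_field R s) : 0 <= x -> x <= y -> to_real x <= to_real y.
Proof.
by move=> x0 xy; rewrite -ler_of_real !to_realK// (le_trans x0).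
Qed.

Definition ksup (A : set (scalar_field R s)) : scalar_field R s :=
  of_real (sup (to_real @` A)).

Lemma ksup_upper_bound (A : set (scalar_field R s)) (M a : scalar_field R s) :
  (forall b, A b -> 0 <= b <= M) -> A a -> a <= ksup A.
Proof.
move=> AM Aa; have /andP[a0 aM] := AM _ Aa.
rewrite -(to_realK a0) ler_of_real; apply: ub_le_sup; last by exists a.
by exists (to_real M) => _ [b Ab <-]; have /andP[? ?] := AM _ Ab; exact: ler_to_real.
Qed.

Lemma ksup_le (A : set (scalar_field R s)) (M : scalar_field R s) :
  A !=set0 -> (forall b, A b -> 0 <= b <= M) -> ksup A <= M.
Proof.
move=> [a Aa] AM; have M0 : 0 <= M.
  by have /andP[/le_trans] := AM _ Aa; apply.
rewrite -(to_realK M0) ler_of_real; apply: ge_sup; first by exists (to_real a), a.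
by move=> _ [b Ab <-]; have /andP[? ?] := AM _ Ab; exact: ler_to_real.
Qed.

Lemma ksup_ge0 (A : set (scalar_field R s)) : (forall b, A b -> 0 <= b) -> 0 <= ksup A.
Proof.
move=> A0; rewrite of_real_ge0.
have A0' : forall r, (to_real @` A) r -> 0 <= r.
  by move=> _ [b Ab <-]; rewrite -of_real_ge0 to_realK; exact: A0.
have [->|/set0P[r Ar]] := eqVneq (to_real @` A) set0; first by rewrite sup0.
have [ubA|nubA] := pselect (has_ubound (to_real @` A)).
  by apply: le_trans (ub_le_sup ubA Ar); exact: A0'.
by rewrite sup_out // => -[].
Qed.

End scalar_field.

Section lspan.
Context {K : numFieldType} {V : lmodType K}.

Definition lspan (A : set V) : set V :=
  [set v | exists n (c : 'I_n -> K) (a : 'I_n -> V),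
     (forall i, A (a i)) /\ v = \sum_(i < n) c i *: a i].

Lemma lspan_submod_closed (A : set V) : submod_closed (mem (lspan A) : {pred V}).
Proof.
split; rewrite ?inE.
  by exists 0%N, (fun=> 0), (fun=> 0); split; [case | rewrite big_ord0].
move=> k u v; rewrite !inE => -[n [c [a [Aa ->]]]] [m [d [b [Ab ->]]]].
exists (n + m)%N, (fun i => match fintype.split i with inl j => k * c j | inr j => d j end).
exists (fun i => match fintype.split i with inl j => a j | inr j => b j end); split.
  by move=> i; case: fintype.split.
rewrite big_split_ord scaler_sumr; congr (_ + _); apply: eq_bigr => i _.
  by rewrite (unsplitK (inl i)) scalerA.
by rewrite (unsplitK (inr i)).
Qed.

HB.instance Definition _ A := GRing.isSubmodClosed.Build _ _
  (mem (lspan A) : {pred V}) (lspan_submod_closed A).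

End lspan.

Section bounded_operators.
Context {R : realType} {s : scalar_kind}.
Local Notation K := (scalar_field R s).
Context {E F : normedModType K}.

Definition blin_pred : {pred E -> F} :=
  mem [set f : E -> F | linear f /\ continuous f].

Lemma blin_submod_closed : submod_closed blin_pred.
Proof.
split; rewrite ?inE /=.
  split; last exact: cst_continuous.
  by move=> k x y; rewrite /= scaler0 addr0.
move=> k f g; rewrite !inE /= => -[lf cf] [lg cg]; split.
  move=> a x y; rewrite !fctE lf lg !scalerDr !scalerA addrACA.
  by rewrite (mulrC k a).
by move=> x; apply: cvgD; [apply: cvgZr; exact: cf|exact: cg].
Qed.

HB.instance Definition _ := GRing.isSubmodClosed.Build _ _
  blin_pred blin_submod_closed.

Record blin := BLin { blin_fun :> E -> F ; _ : blin_fun \in blin_pred }.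

HB.instance Definition _ := [isSub for blin_fun].
HB.instance Definition _ := [Choice of blin by <:].
HB.instance Definition _ := [SubChoice_isSubLmodule of blin by <:].

Implicit Types f g : blin.

Lemma blin_continuous f : continuous f.
Proof. by case: f => /= f; rewrite inE => -[]. Qed.

Lemma blin_is_linear f : linear f.
Proof. by case: f => /= f; rewrite inE => -[]. Qed.

HB.instance Definition _ f := GRing.isLinear.Build K E F *:%R f (blin_is_linear f).

Lemma blinD f g x : (f + g) x = f x + g x. Proof. by []. Qed.
Lemma blinZ k f x : (k *: f) x = k *: f x. Proof. by []. Qed.

Definition blin_norm f : K := ksup [set `|f x| | x in [set x | `|x| <= 1]].

Lemma blin_bounded f : exists2 M, 0 <= M & forall x, `|f x| <= M * `|x|.
Proof.
have /linear_bounded_continuous/linear_boundedP/pinfty_ex_gt0 [M M0 fM] :=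
  @blin_continuous f.
by exists M => //; exact: ltW.
Qed.

Lemma blin_norm_ub f x : `|x| <= 1 -> `|f x| <= blin_norm f.
Proof.
move=> x1; have [M M0 fM] := blin_bounded f.
apply: (@ksup_upper_bound _ _ _ M); last by exists x.
move=> _ [y y1 <-]; rewrite normr_ge0 (le_trans (fM y))//.
by rewrite -[leRHS]mulr1 ler_wpM2l.
Qed.

Lemma blin_norm_ge0 f : 0 <= blin_norm f.
Proof. by apply: ksup_ge0 => _ [x _ <-]. Qed.

Lemma blin_norm_le f M :
  (forall x, `|x| <= 1 -> `|f x| <= M) -> blin_norm f <= M.
Proof.
move=> fM; apply: ksup_le; first by exists `|f 0|, 0; rewrite //= normr0.
by move=> _ [x x1 <-]; rewrite normr_ge0 fM.
Qed.

Lemma ler_blin_norm f x : `|f x| <= blin_norm f * `|x|.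
Proof.
have [->|x0] := eqVneq x 0; first by rewrite linear0 !normr0 mulr0.
have := @blin_norm_ub f (`|x|^-1 *: x).
rewrite normfZV// lexx linearZ /= normrZ normfV normr_id => /(_ isT).
by rewrite ler_pdivrMl ?normr_gt0// mulrC.
Qed.

Lemma ler_blin_normD f g : blin_norm (f + g) <= blin_norm f + blin_norm g.
Proof.
apply: blin_norm_le => x x1; rewrite blinD (le_trans (ler_normD _ _))//.
by rewrite lerD// blin_norm_ub.
Qed.

Lemma blin_normZ k f : blin_norm (k *: f) = `|k| * blin_norm f.
Proof.
have le_normZ c h : blin_norm (c *: h) <= `|c| * blin_norm h.
  apply: blin_norm_le => x x1; rewrite blinZ normrZ ler_wpM2l//.
  exact: blin_norm_ub.
apply/eqP; rewrite eq_le le_normZ /=.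
have [->|k0] := eqVneq k 0; first by rewrite normr0 mul0r blin_norm_ge0.
rewrite -ler_pdivlMl ?normr_gt0// -normfV.
by apply: le_trans (le_normZ _ _); rewrite scalerA mulVf// scale1r.
Qed.

Lemma blin_norm_eq0 f : blin_norm f = 0 -> f = 0.
Proof.
move=> f0; apply/val_inj/funext => x /=; apply/eqP; rewrite -normr_le0.
by rewrite (le_trans (ler_blin_norm f x))// f0 mul0r.
Qed.

HB.instance Definition _ :=
  Lmodule_isNormed.Build K blin ler_blin_normD blin_normZ blin_norm_eq0.

Lemma blin_normE f : `|f| = blin_norm f. Proof. by []. Qed.

End bounded_operators.
Arguments blin {R s} E F.
Arguments BLin {R s E F}.

Notation topdual E := (blin E (scalar_field _ _)^o).

Section lipschitz_functions.
Context {R : realType} {s : scalar_kind}.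
Local Notation K := (scalar_field R s).
Context {X : metricType R} (x0 : X) {F : normedModType K}.

Definition lip_const (f : X -> F) (C : R) :=
  0 <= C /\ forall x y, `|f x - f y| <= of_real (C * mdist x y).

Definition lip0_pred : {pred X -> F} :=
  mem [set f : X -> F | f x0 = 0 /\ exists C, lip_const f C].

Lemma lip_constD f g C D :
  lip_const f C -> lip_const g D -> lip_const (f + g) (C + D).
Proof.
move=> [C0 fC] [D0 gD]; split; first exact: addr_ge0.
move=> x y; rewrite !fctE opprD addrACA (le_trans (ler_normD _ _))//.
by rewrite mulrDl of_realD lerD.
Qed.

Lemma lip_constZ (k : K) f C :
  lip_const f C -> lip_const (k *: f) (to_real `|k| * C).
Proof.
move=> [C0 fC]; split.
  by rewrite mulr_ge0// -(@of_real_ge0 R s) to_realK.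
move=> x y; rewrite !fctE -scalerBr normrZ -mulrA of_realM to_realK//.
by rewrite ler_wpM2l.
Qed.

Lemma lip0_submod_closed : submod_closed lip0_pred.
Proof.
split; rewrite ?inE /=.
  split => //; exists 0; split=> // x y.
  by rewrite mul0r of_real0 subrr normr0.
move=> k f g; rewrite !inE /= => -[f0 [C fC]] [g0 [D gD]]; split.
  by rewrite !fctE f0 g0 scaler0 addr0.
by exists (to_real `|k| * C + D); apply: lip_constD => //; exact: lip_constZ.
Qed.

HB.instance Definition _ := GRing.isSubmodClosed.Build _ _
  lip0_pred lip0_submod_closed.

Record lip0 := Lip0 { lip0_fun :> X -> F ; _ : lip0_fun \in lip0_pred }.

HB.instance Definition _ := [isSub for lip0_fun].
HB.instance Definition _ := [Choice of lip0 by <:].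
HB.instance Definition _ := [SubChoice_isSubLmodule of lip0 by <:].

Implicit Types f g : lip0.

Lemma lip0_base f : f x0 = 0.
Proof. by case: f => /= f; rewrite inE => -[]. Qed.

Lemma lip0_const f : exists C, lip_const f C.
Proof. by case: f => /= f; rewrite inE => -[]. Qed.

Lemma lip0D f g x : (f + g) x = f x + g x. Proof. by []. Qed.
Lemma lip0Z k f x : (k *: f) x = k *: f x. Proof. by []. Qed.

Lemma lip0_sum I (r : seq I) (P : pred I) (f : I -> lip0) x :
  (\sum_(i <- r | P i) f i) x = \sum_(i <- r | P i) f i x.
Proof. by elim/big_rec2: _ => //= i y1 y2 _ <-. Qed.

Definition lip_norm f : K := of_real (inf [set C | lip_const f C]).

Let has_lbound_lip_const f : has_lbound [set C | lip_const f C].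
Proof. by exists 0 => C []. Qed.

Lemma lip_norm_ge0 f : 0 <= lip_norm f.
Proof.
rewrite of_real_ge0; apply: lb_le_inf; last by move=> C [].
by have [C fC] := lip0_const f; exists C.
Qed.

Lemma lip_norm_le f C : lip_const f C -> lip_norm f <= of_real C.
Proof. by move=> fC; rewrite ler_of_real; exact: ge_inf. Qed.

Lemma ler_lip_norm f x y :
  `|f x - f y| <= lip_norm f * of_real (mdist x y).
Proof.
have [->|xy] := eqVneq x y.
  by rewrite subrr normr0 mulr_ge0 ?lip_norm_ge0// of_real_ge0 mdist_ge0.
have d0 : 0 < mdist x y by rewrite mdist_gt0.
rewrite -of_realM -[leLHS]to_realK// ler_of_real -ler_pdivrMr//.
apply: lb_le_inf => [|C [C0 fC]].
  by have [C fC] := lip0_const f; exists C.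
by rewrite ler_pdivrMr// -(@ler_of_real R s) to_realK.
Qed.

Lemma lip_norm_const f : lip_const f (to_real (lip_norm f)).
Proof.
split; first by rewrite of_realK -(@of_real_ge0 R s) lip_norm_ge0.
by move=> x y; rewrite of_realM to_realK ?lip_norm_ge0// ler_lip_norm.
Qed.

Lemma ler_lip_normD f g : lip_norm (f + g) <= lip_norm f + lip_norm g.
Proof.
rewrite -[leRHS]to_realK ?addr_ge0 ?lip_norm_ge0//.
apply: lip_norm_le; rewrite -(to_realK (lip_norm_ge0 f)).
rewrite -(to_realK (lip_norm_ge0 g)) -of_realD of_realK.
by apply: lip_constD; exact: lip_norm_const.
Qed.

Lemma lip_normZ k f : lip_norm (k *: f) = `|k| * lip_norm f.
Proof.
have le_normZ c h : lip_norm (c *: h) <= `|c| * lip_norm h.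
  rewrite -(to_realK (lip_norm_ge0 h)) -(to_realK (normr_ge0 c)) -of_realM.
  by apply: lip_norm_le; apply: lip_constZ; exact: lip_norm_const.
apply/eqP; rewrite eq_le le_normZ /=.
have [->|k0] := eqVneq k 0; first by rewrite normr0 mul0r lip_norm_ge0.
rewrite -ler_pdivlMl ?normr_gt0// -normfV.
by apply: le_trans (le_normZ _ _); rewrite scalerA mulVf// scale1r.
Qed.

Lemma lip_norm_eq0 f : lip_norm f = 0 -> f = 0.
Proof.
move=> f0; apply/val_inj/funext => x /=; apply/eqP; rewrite -normr_le0.
rewrite -[X in `|X|]subr0 -(lip0_base f) (le_trans (ler_lip_norm f x x0))//.
by rewrite f0 mul0r.
Qed.

HB.instance Definition _ :=
  Lmodule_isNormed.Build K lip0 ler_lip_normD lip_normZ lip_norm_eq0.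

Lemma lip_normE f : `|f| = lip_norm f. Proof. by []. Qed.

End lipschitz_functions.
Arguments lip0 {R s X} x0 F.
Arguments Lip0 {R s X x0 F}.

Notation lipdual s x0 := (lip0 x0 (scalar_field _ s)^o).

Section separation.
Context {R : realType} {s : scalar_kind} {X : metricType R}.
Local Notation K := (scalar_field R s).

Lemma dist_min (p : X) (S : seq X) :
  exists2 r, 0 < r & forall q, q \in S -> q != p -> r <= mdist q p.
Proof.
elim: S => [|q S [r r0 rS]]; first by exists 1.
have [->|qp] := eqVneq q p.
  exists r => // q'; rewrite inE => /orP[/eqP ->|]; last exact: rS.
  by rewrite eqxx.
exists (Order.min r (mdist q p)); first by rewrite lt_min r0 mdist_gt0.
move=> q'; rewrite inE ge_min => /orP[/eqP ->|q'S q'p]; first by rewrite lexx orbT.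
by rewrite rS.
Qed.

Let bump (p : X) (r : R) (x : X) : K^o :=
  of_real (Num.max 0 (1 - mdist x p / r)).

Let bump_lip p r : 0 < r -> lip_const (bump p r) r^-1.
Proof.
move=> r0; split=> [|x y]; first by rewrite invr_ge0 ltW.
rewrite /bump.
have -> a b : of_real a - of_real b = of_real (a - b) :> K^o.
  by apply/eqP; rewrite subr_eq -of_realD subrK.
rewrite norm_of_real ler_of_real.
have maxB (a b : R) : `|Num.max 0 a - Num.max 0 b| <= `|a - b|.
  rewrite /Num.max; case: ltP => a0; case: ltP => b0 //.
  - by rewrite subr0 gtr0_norm// (le_trans _ (ler_norm _))// lerDl oppr_ge0.
  - by rewrite sub0r normrN gtr0_norm// distrC (le_trans _ (ler_norm _))// lerDl oppr_ge0.
  - by rewrite subrr normr0.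
apply: le_trans (maxB _ _) _.
rewrite opprB addrCA addrAC subrr add0r -mulrBl normrM mulrC.
rewrite gtr0_norm ?invr_gt0// ler_wpM2l ?invr_ge0 ?(ltW r0)//.
rewrite ler_distl; apply/andP; split.
  by rewrite lerBlDr addrC metric_triangle.
by rewrite addrC (metric_sym x y) metric_triangle.
Qed.

Lemma lipdual_separates (x0 p : X) (S : seq X) : p != x0 ->
  exists2 g : lipdual s x0, g p = 1 & forall q, q \in S -> q != p -> g q = 0.
Proof.
move=> px0; have [r r0 rS] := dist_min p (x0 :: S).
have bump0 q : q \in x0 :: S -> q != p -> bump p r q = 0.
  move=> qS qp; rewrite /bump max_l ?of_real0// subr_le0 ler_pdivlMr// mul1r.
  exact: rS.
have bump_lip0 : bump p r \in lip0_pred x0.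
  rewrite inE /=; split; first by rewrite bump0 ?mem_head// eq_sym.
  by exists r^-1; exact: bump_lip.
exists (Lip0 _ bump_lip0) => /=.
  by rewrite /bump mdistxx mul0r subr0 max_r ?of_real1.
by move=> q qS; apply: bump0; rewrite inE qS orbT.
Qed.

End separation.

Section algebraic_dual.
Context {K : numFieldType} {V : lmodType K}.

Definition algdual_pred : {pred V -> K^o} := mem [set phi : V -> K^o | linear phi].

Lemma algdual_submod_closed : submod_closed algdual_pred.
Proof.
split; rewrite ?inE /=; first by move=> k x y; rewrite /= scaler0 addr0.
move=> k f g; rewrite !inE /= => lf lg a x y.
by rewrite !fctE lf lg !scalerDr !scalerA addrACA (mulrC k a).
Qed.

HB.instance Definition _ := GRing.isSubmodClosed.Build _ _
  algdual_pred algdual_submod_closed.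

Record algdual := AlgDual
  { algdual_fun :> V -> K^o ; _ : algdual_fun \in algdual_pred }.

HB.instance Definition _ := [isSub for algdual_fun].
HB.instance Definition _ := [Choice of algdual by <:].
HB.instance Definition _ := [SubChoice_isSubLmodule of algdual by <:].

Lemma algdual_is_linear (phi : algdual) : linear phi.
Proof. by case: phi => /= phi; rewrite inE. Qed.

HB.instance Definition _ (phi : algdual) :=
  GRing.isLinear.Build K V K^o *:%R phi (algdual_is_linear phi).

Lemma algdualD (phi psi : algdual) v : (phi + psi) v = phi v + psi v.
Proof. by []. Qed.

Lemma algdualZ k (phi : algdual) v : (k *: phi) v = k *: phi v.
Proof. by []. Qed.

Lemma algdual_sum I (r : seq I) (P : pred I) (phi : I -> algdual) v :
  (\sum_(i <- r | P i) phi i) v = \sum_(i <- r | P i) phi i v.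
Proof. by elim/big_rec2: _ => //= i y1 y2 _ <-. Qed.

End algebraic_dual.
Arguments algdual {K} V.
Arguments AlgDual {K V}.

Section lipschitz_tensor_product.
Context {R : realType} {s : scalar_kind}.
Local Notation K := (scalar_field R s).
Context {X : metricType R} (x0 : X) {E : normedModType K}.
Local Notation Lip0E' := (lip0 x0 (topdual E)).

Let dirac_fun (x y : X) (e : E) (f : Lip0E') : K^o := (f x - f y) e.

Let dirac_fun_linear x y e : dirac_fun x y e \in algdual_pred.
Proof.
rewrite inE /= => k f g; rewrite /dirac_fun !lip0D !lip0Z.
by rewrite !(blinD, blinZ) opprD addrACA scalerBr.
Qed.

Definition dirac_box x y e : algdual Lip0E' :=
  AlgDual (dirac_fun x y e) (dirac_fun_linear x y e).

Lemma dirac_boxE x y e f : dirac_box x y e f = (f x - f y) e.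
Proof. by []. Qed.

Lemma dirac_boxZ k x y e : k *: dirac_box x y e = dirac_box x y (k *: e).
Proof.
apply/val_inj/funext => f.
by rewrite -[RHS]/((f x - f y) (k *: e)) [RHS]linearZ.
Qed.

Definition dirac_boxes : set (algdual Lip0E') :=
  [set u | exists x y e, u = dirac_box x y e].

Record lip_tensor := LipTensor
  { lip_tensor_val :> algdual Lip0E' ;
    _ : lip_tensor_val \in (mem (lspan dirac_boxes) : {pred algdual Lip0E'}) }.

HB.instance Definition _ := [isSub for lip_tensor_val].
HB.instance Definition _ := [Choice of lip_tensor by <:].
HB.instance Definition _ := [SubChoice_isSubLmodule of lip_tensor by <:].

Let dirac_box_lspan x y e :
  dirac_box x y e \in (mem (lspan dirac_boxes) : {pred algdual Lip0E'}).
Proof.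
rewrite inE; exists 1%N, (fun=> 1), (fun=> dirac_box x y e).
by split=> [_|]; [exists x, y, e | rewrite big_ord1 scale1r].
Qed.

Definition boxtimes x y e : lip_tensor := LipTensor (dirac_box_lspan x y e).

Lemma lip_tensorZ (k : K) (u : lip_tensor) f : (k *: u) f = k *: u f.
Proof. by []. Qed.

Lemma lip_tensorD (u v : lip_tensor) f : (u + v) f = u f + v f.
Proof. by []. Qed.

Lemma boxtimesZ k x y e : k *: boxtimes x y e = boxtimes x y (k *: e).
Proof. by apply/val_inj; exact: dirac_boxZ. Qed.

Lemma boxtimes_sumE n (x y : 'I_n -> X) (e : 'I_n -> E) f :
  (\sum_(i < n) boxtimes (x i) (y i) (e i) : lip_tensor) f =
  \sum_(i < n) (f (x i) - f (y i)) (e i).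
Proof.
rewrite (_ : lip_tensor_val _ = \sum_(i < n) dirac_box (x i) (y i) (e i)).
  by rewrite algdual_sum.
by elim/big_rec2: _ => // i u v _ <-.
Qed.

Lemma lip_tensor_repr (u : lip_tensor) :
  exists n (x y : 'I_n -> X) (e : 'I_n -> E),
    u = \sum_(i < n) boxtimes (x i) (y i) (e i).
Proof.
case: u => u u_mem; have := u_mem; rewrite inE => u_span.
have [n [c [a [ha uE]]]] := u_span.
pose p i := projT1 (cid (ha i)); pose hp i := projT2 (cid (ha i)).
pose q i := projT1 (cid (hp i)); pose hq i := projT2 (cid (hp i)).
pose r i := projT1 (cid (hq i)); pose hr i := projT2 (cid (hq i)).
exists n, p, q, (fun i => c i *: r i); apply/val_inj => /=.
rewrite uE; apply/esym.
transitivity (\sum_(i < n) dirac_box (p i) (q i) (c i *: r i)).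
  by elim/big_rec2: _ => // i v w _ <-.
by apply: eq_bigr => i _; rewrite -dirac_boxZ {1}(hr i).
Qed.

(* The representation of [u] is not unique: the supremum below runs over all of
   them, which is harmless by [inj_norm_sum]. *)
Definition inj_norm (u : lip_tensor) : K :=
  ksup [set r | exists n (x y : 'I_n -> X) (e : 'I_n -> E),
    u = \sum_(i < n) boxtimes (x i) (y i) (e i) /\
    exists (g : lipdual s x0) (phi : topdual E), [/\ `|g| <= 1, `|phi| <= 1 &
      r = `|\sum_(i < n) (g (x i) - g (y i)) * phi (e i)|]].

(* Evaluating u at the maps x |-> g x *: phi recovers the sums defining its norm,
   whence the independence of the representation. *)
Let lip_smul_fun (g : lipdual s x0) (phi : topdual E) : X -> topdual E :=
  fun x => g x *: phi.

Let lip_smul_lip0 g phi : lip_smul_fun g phi \in lip0_pred x0.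
Proof.
rewrite inE /= /lip_smul_fun; split; first by rewrite lip0_base scale0r.
exists (to_real (lip_norm g) * to_real `|phi|); split.
  by rewrite mulr_ge0// -(@of_real_ge0 R s) to_realK// lip_norm_ge0.
move=> x y; rewrite -scalerBl normrZ mulrAC !of_realM !to_realK ?lip_norm_ge0//.
by rewrite ler_wpM2r// ler_lip_norm.
Qed.

Definition lip_smul g phi : Lip0E' :=
  Lip0 (lip_smul_fun g phi) (lip_smul_lip0 g phi).

Lemma boxtimes_sum_lip_smul n (x y : 'I_n -> X) (e : 'I_n -> E) g phi :
  (\sum_(i < n) boxtimes (x i) (y i) (e i) : lip_tensor) (lip_smul g phi) =
  \sum_(i < n) (g (x i) - g (y i)) * phi (e i).
Proof.
rewrite boxtimes_sumE; apply: eq_bigr => i _.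
by rewrite /= /lip_smul_fun -scalerBl.
Qed.

Lemma inj_norm_sum n (x y : 'I_n -> X) (e : 'I_n -> E) :
  inj_norm (\sum_(i < n) boxtimes (x i) (y i) (e i)) =
  ksup [set r | exists (g : lipdual s x0) (phi : topdual E),
    [/\ `|g| <= 1, `|phi| <= 1 &
        r = `|\sum_(i < n) (g (x i) - g (y i)) * phi (e i)|]].
Proof.
congr ksup; apply/seteqP; split=> r /=; last first.
  by move=> rE; exists n, x, y, e.
move=> [m [x' [y' [e' [uE [g [phi [g1 phi1 ->]]]]]]]]; exists g, phi; split => //.
by rewrite -!boxtimes_sum_lip_smul uE.
Qed.

Lemma inj_normE (u : lip_tensor) : inj_norm u =
  ksup [set r | exists (g : lipdual s x0) (phi : topdual E),
    [/\ `|g| <= 1, `|phi| <= 1 & r = `|u (lip_smul g phi)|]].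
Proof.
have [n [x [y [e ->]]]] := lip_tensor_repr u.
rewrite inj_norm_sum; congr ksup; apply/seteqP; split=> r /= [g [phi]];
  by rewrite -?boxtimes_sum_lip_smul => *; exists g, phi;
     rewrite -?boxtimes_sum_lip_smul.
Qed.

Lemma lip_tensor_bounded (u : lip_tensor) : exists M, forall (g : lipdual s x0) (phi : topdual E),
  `|g| <= 1 -> `|phi| <= 1 -> `|u (lip_smul g phi)| <= M.
Proof.
have [n [x [y [e ->]]]] := lip_tensor_repr u.
exists (\sum_(i < n) of_real (mdist (x i) (y i)) * `|e i|) => g phi g1 phi1.
rewrite boxtimes_sum_lip_smul (le_trans (ler_norm_sum _ _ _))//.
apply: ler_sum => i _; rewrite normrM ler_pM//.
  rewrite (le_trans (ler_lip_norm _ _ _))// ler_piMl//.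
  by rewrite of_real_ge0 mdist_ge0.
by rewrite (le_trans (ler_blin_norm _ _))// ler_piMl.
Qed.

Lemma inj_norm_ub (u : lip_tensor) (g : lipdual s x0) (phi : topdual E) :
  `|g| <= 1 -> `|phi| <= 1 -> `|u (lip_smul g phi)| <= inj_norm u.
Proof.
move=> g1 phi1; rewrite inj_normE.
have [M uM] := lip_tensor_bounded u; apply: (@ksup_upper_bound _ _ _ M).
  by move=> _ [h [psi [h1 psi1 ->]]]; rewrite normr_ge0 uM.
by exists g, phi.
Qed.

Lemma inj_norm_le (u : lip_tensor) (M : K) :
  (forall (g : lipdual s x0) (phi : topdual E),
    `|g| <= 1 -> `|phi| <= 1 -> `|u (lip_smul g phi)| <= M) ->
  inj_norm u <= M.
Proof.
move=> uM; rewrite inj_normE; apply: ksup_le.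
  by exists `|u (lip_smul 0 0)|, 0, 0; rewrite !normr0 ler01.
by move=> _ [g [phi [g1 phi1 ->]]]; rewrite normr_ge0 uM.
Qed.

Lemma inj_norm_ge0 u : 0 <= inj_norm u.
Proof. by apply: ksup_ge0 => _ [? [? [? [? [_ [? [? [_ _ ->]]]]]]]]. Qed.

Lemma ler_inj_normD u v : inj_norm (u + v) <= inj_norm u + inj_norm v.
Proof.
apply: inj_norm_le => g phi g1 phi1; rewrite lip_tensorD.
by rewrite (le_trans (ler_normD _ _))// lerD// inj_norm_ub.
Qed.

Lemma inj_normZ k u : inj_norm (k *: u) = `|k| * inj_norm u.
Proof.
have le_normZ c v : inj_norm (c *: v) <= `|c| * inj_norm v.
  apply: inj_norm_le => g phi g1 phi1; rewrite lip_tensorZ normrZ ler_wpM2l//.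
  exact: inj_norm_ub.
apply/eqP; rewrite eq_le le_normZ /=.
have [->|k0] := eqVneq k 0; first by rewrite normr0 mul0r inj_norm_ge0.
rewrite -ler_pdivlMl ?normr_gt0// -normfV.
by apply: le_trans (le_normZ _ _); rewrite scalerA mulVf// scale1r.
Qed.

Lemma inj_norm_eq0 u : inj_norm u = 0 -> u = 0.
Proof.
move=> u0.
have lip_smulZ a g b phi : lip_smul (a *: g) (b *: phi) =
    (a * b) *: lip_smul g phi.
  apply/val_inj/funext => x; rewrite /= /lip_smul_fun lip0Z.
  by rewrite -[RHS]/((a * b) *: (g x *: phi)) !scalerA mulrAC.
have u_smul g phi : u (lip_smul g phi) = 0.
  have [->|g0] := eqVneq g 0.
    by rewrite -(scale0r 0) -(scale1r phi) lip_smulZ mul0r scale0r linear0.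
  have [->|phi0] := eqVneq phi 0.
    by rewrite -(scale0r 0) -(scale1r g) lip_smulZ mulr0 scale0r linear0.
  rewrite -[g in lip_smul g](scalerKV (a := `|g|)) ?normr_eq0//.
  rewrite -[phi in lip_smul _ phi](scalerKV (a := `|phi|)) ?normr_eq0//.
  rewrite lip_smulZ linearZ /=.
  have := @inj_norm_ub u (`|g|^-1 *: g) (`|phi|^-1 *: phi).
  rewrite !normfZV// lexx u0 => /(_ isT isT); rewrite normr_le0 => /eqP ->.
  by rewrite scaler0.
have [n [x [y [e uE]]]] := lip_tensor_repr u.
pose S := undup ([seq x i | i <- enum 'I_n] ++ [seq y i | i <- enum 'I_n]).
have xS i : x i \in S by rewrite mem_undup mem_cat map_f ?mem_enum.
have yS i : y i \in S by rewrite mem_undup mem_cat orbC map_f ?mem_enum.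
have /choice[g gP] p : exists g : lipdual s x0, p != x0 ->
    g p = 1 /\ forall q, q \in S -> q != p -> g q = 0.
  have [->|px0] := eqVneq p x0; first by exists 0.
  by have [g gp gS] := @lipdual_separates R s X x0 p S px0; exists g.
apply/val_inj/val_inj/funext => f.
pose f' : Lip0E' := \sum_(p <- S | p != x0) lip_smul (g p) (f p).
have ff' q : q \in S -> f' q = f q.
  move=> qS; rewrite lip0_sum.
  rewrite (eq_bigr (fun p => g p q *: f p))//.
  have [->|qx0] := eqVneq q x0.
    by rewrite lip0_base big1// => p _; rewrite lip0_base scale0r.
  rewrite -big_filter (bigD1_seq q) ?filter_uniq ?undup_uniq ?mem_filter ?qx0//=.
  have [-> _] := gP _ qx0; rewrite scale1r big_filter_cond big1 ?addr0// => p.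
  move=> /andP[px0 pq]; have [_ gp0] := gP _ px0; rewrite gp0 ?scale0r//.
  by rewrite eq_sym.
transitivity (u f); first by [].
transitivity (u f').
  by rewrite uE !boxtimes_sumE; apply: eq_bigr => i _; rewrite !ff'.
by rewrite linear_sum big1// => p _; exact: u_smul.
Qed.

HB.instance Definition _ :=
  Lmodule_isNormed.Build K lip_tensor ler_inj_normD inj_normZ inj_norm_eq0.

Lemma lip_tensor_normE (u : lip_tensor) : `|u| = inj_norm u. Proof. by []. Qed.

End lipschitz_tensor_product.
Arguments lip_tensor {R s X} x0 E.
Arguments LipTensor {R s X x0 E}.
Arguments boxtimes {R s X x0 E}.

Section finite_rank_operators.
Context {R : realType} {s : scalar_kind}.
Local Notation K := (scalar_field R s).
Context {X : metricType R} {x0 : X} {E : normedModType K}.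

Definition lipdual_ptws : topologicalType :=
  initial_topology (fun g : lipdual s x0 => (lip0_fun g : {ptws X -> K^o})).

Definition finite_rank (S : lipdual s x0 -> E) :=
  exists n (b : 'I_n -> E), range S = lspan (range b).

(* Being an element of [blin] is no restriction on a linear S that is
   continuous for pointwise convergence, see [continuous_ptwsW]. *)
Definition finite_rank_ptws : set (blin (lipdual s x0) E) :=
  [set S : blin (lipdual s x0) E |
    finite_rank S /\ continuous (S : lipdual_ptws -> E)].

Lemma continuous_id_ptws : continuous (id : lipdual s x0 -> lipdual_ptws).
Proof.
apply: (@continuous_comp_initial _ _ _ _ (id : lipdual s x0 -> lipdual_ptws)).
move=> g; have FF : Filter (nbhs g) by exact: nbhs_filter.
apply: (iffRL (@pointwise_cvgP _ _ _ (lip0_fun g) _)) => x.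
apply/(@cvgrPdist_lt _ _ _ (nbhs g)) => e e0.
have d1 : 0 < of_real (mdist x x0) + 1 :> K.
  by rewrite ltr_wpDl// of_real_ge0 mdist_ge0.
near=> h.
have -> : g x - h x = (g - h) x by [].
rewrite -[(g - h) x]subr0 -(lip0_base (g - h)).
apply: le_lt_trans (ler_lip_norm _ _ _) _.
have le_d : of_real (mdist x x0) <= of_real (mdist x x0) + 1 :> K.
  by rewrite lerDl.
apply: le_lt_trans (ler_wpM2l (lip_norm_ge0 _) le_d) _.
rewrite -lip_normE -ltr_pdivlMr//.
near: h; apply: cvgr_dist_lt => //; exact: divr_gt0.
Unshelve. all: by end_near. Qed.

Lemma continuous_ptwsW (S : lipdual s x0 -> E) :
  continuous (S : lipdual_ptws -> E) -> continuous (S : lipdual s x0 -> E).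
Proof.
move=> cS g; have := @continuous_id_ptws g; rewrite /continuous_at /=.
move=> cid_g; apply: (cvg_comp _ _ cid_g (cS g)).
Qed.

End finite_rank_operators.
Arguments finite_rank_ptws {R s X} x0 E.

Definition isometric_isomorphism (K : numFieldType) (V W : normedModType K)
    (A : set W) (J : V -> W) :=
  [/\ linear J, forall v, `|J v| = `|v| & set_bij [set: V] A J].

Definition is_completion (K : numFieldType) (V : normedModType K)
    (W : completeNormedModType K) (i : V -> W) :=
  [/\ linear i, forall v, `|i v| = `|v| & dense (range i)].

(* Main.v *)
Require Import Defs.
From HB Require Import structures.
From mathcomp Require Import all_boot all_order all_algebra.
From mathcomp Require Import all_classical all_reals topology normedtype.
From mathcomp.real_closed Require Import complex.
From mathcomp Require Import ring lra.

Set Implicit Arguments.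
Unset Strict Implicit.
Unset Printing Implicit Defensive.

Import Order.TTheory GRing.Theory Num.Theory numFieldNormedType.Exports.
Local Open Scope classical_set_scope.
Local Open Scope ring_scope.

(** Applying a functional phi of E to the vector J(u)(g) gives the value of the
tensor u at the Lipschitz map x |-> g x *: phi. Since the dual of E separates
points, this identity ([represents]) determines J(u) from u alone, so that J is
well defined and linear; and since every vector of E is normed by some phi of
norm at most 1, taking suprema over g and phi turns the identity into
|J(u)| = epsilon(u). Both facts about the dual are the Hahn-Banach theorem
([norming_functional]). It is obtained here from minimal sublinear functionals:
by Zorn's lemma every sublinear functional dominates a minimal one, and a minimal
one q is linear because x |-> inf_(t >= 0) (q (x + t v) - t q v) is again
sublinear and below q, hence equal to q, which forces q (x + v) = q x + q v.
Complex functionals are recovered from their real parts.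

For surjectivity, let S be linear and continuous for pointwise convergence. The
functions vanishing on a finite set of points, as this set grows, converge
pointwise to 0, so |S h| < 1 for all functions h vanishing on a suitable finite
set A, and by homogeneity S h = 0 for them. If the functions b_p are 1 at p and 0 at
the other points of A, then g - sum_p g(p) b_p vanishes on A, whence
S g = sum_p g(p) S(b_p) ([ptws_continuous_expansion]). This exhibits S as J of the
tensor with terms (p, x0, S(b_p)), and also shows that S has finite rank.

For the completion, the operators from the Lipschitz dual to E form a complete
space ([blin_complete]). Two isometries i and j of a space V into complete spaces
identify the closures of their ranges: w and z correspond when they are limits of
i and j along the same filter on V ([closure_isometric_isomorphism]). Here i is
the embedding of the tensor product in its completion, and j is J. *)

(** * The Hahn-Banach theorem from minimal sublinear functionals *)

Section hahn_banach.
Context {R : realType} {V : lmodType R}.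
Implicit Types (p q : V -> R) (x y v : V).

(** For r > 0 the inequality is an equality, see [sublinearZ]; the one-sided form
passes to pointwise infima without case analysis. *)
Definition sublinear q :=
  (forall x y, q (x + y) <= q x + q y) /\
  (forall r x, 0 < r -> q (r *: x) <= r * q x).

Lemma sublinearZ q r x : sublinear q -> 0 < r -> q (r *: x) = r * q x.
Proof.
move=> [_ qZ] r0; apply/eqP; rewrite eq_le qZ//=.
have := qZ r^-1 (r *: x); rewrite invr_gt0 => /(_ r0).
by rewrite scalerA mulVf ?gt_eqF// scale1r ler_pdivlMl.
Qed.

Lemma sublinear0 q : sublinear q -> q 0 = 0.
Proof.
move=> sq; have /(_ ltac:(by [])) := @sublinearZ q 2 0 sq.
by rewrite scaler0 => q0; lra.
Qed.

Lemma sublinear_geN q x : sublinear q -> - q (- x) <= q x.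
Proof.
by move=> sq; rewrite -subr_ge0 opprK -(sublinear0 sq) -{1}(subrr x) (proj1 sq).
Qed.

(** Serves twice: for the infimum of a chain, where q1 and q2 are comparable, and
for the infimum over t >= 0 in [sublinear_descent], where t adds up. *)
Lemma inf_sublinear (Q : set (V -> R)) (l : V -> R) : Q !=set0 ->
  (forall q x, Q q -> l x <= q x) ->
  (forall q1 q2 x y, Q q1 -> Q q2 -> exists2 q, Q q & q (x + y) <= q1 x + q2 y) ->
  (forall q r x, Q q -> 0 < r -> exists2 q', Q q' & q' (r *: x) <= r * q x) ->
  sublinear (fun x => inf [set q x | q in Q]).
Proof.
move=> [q0 Qq0] lQ QD QZ.
have Qn0 x : [set q x | q in Q] !=set0 by exists (q0 x), q0.
have infQ q x : Q q -> inf [set q x | q in Q] <= q x.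
  move=> Qq; apply: ge_inf; last by exists q.
  by exists (l x) => _ [q' Qq' <-]; exact: lQ.
split=> [x y|r x r0].
  rewrite -lerBlDl; apply: lb_le_inf => // _ [q2 Qq2 <-].
  rewrite lerBlDr -lerBlDl; apply: lb_le_inf => // _ [q1 Qq1 <-].
  rewrite lerBlDr; have [q Qq qle] := QD _ _ x y Qq1 Qq2.
  by apply: le_trans (infQ _ _ Qq) _.
rewrite -ler_pdivrMl//; apply: lb_le_inf => // _ [q Qq <-].
rewrite ler_pdivrMl//; have [q' Qq' qle] := QZ _ r x Qq r0.
by apply: le_trans (infQ _ _ Qq') _.
Qed.

(** The functional x |-> inf_(t >= 0) (q (x + t v) - t q v): the bounds come from
t = 0 and t = 1, and the infimum is finite because t q v = q (t v) is at most
q (x + t v) + q (- x). *)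
Lemma sublinear_descent q v : sublinear q -> exists q',
  [/\ sublinear q', forall x, q' x <= q x & forall x, q' x <= q (x + v) - q v].
Proof.
move=> sq; have [qD qZ] := sq.
pose step t x := q (x + t *: v) - t * q v.
pose Q := [set step t | t in [set t | 0 <= t]].
have tZ t : 0 <= t -> q (t *: v) = t * q v.
  rewrite le_eqVlt => /predU1P[<-|]; last exact: sublinearZ.
  by rewrite scale0r mul0r sublinear0.
have lQ t x : 0 <= t -> - q (- x) <= step t x.
  move=> t0; rewrite /step lerBrDr addrC lerBlDr -tZ//.
  by rewrite -{1}(addrK x (t *: v)) (addrC _ x) qD.
have infQ t x : 0 <= t -> inf [set q x | q in Q] <= step t x.
  move=> t0; apply: ge_inf; last by exists (step t) => //; exists t.
  by exists (- q (- x)) => _ [_ [t' t'0 <-] <-]; exact: lQ.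
exists (fun x => inf [set q x | q in Q]); split=> [|x|x].
- apply: (@inf_sublinear _ (fun x => - q (- x))).
  + by exists (step 0), 0 => /=.
  + by move=> _ x [t t0 <-]; exact: lQ.
  + move=> _ _ x y [t t0 <-] [u u0 <-]; exists (step (t + u)).
      by exists (t + u) => //=; exact: addr_ge0.
    rewrite /step scalerDl addrACA mulrDl opprD [leRHS]addrACA lerD2r; exact: qD.
  + move=> _ r x [t t0 <-] r0; exists (step (r * t)).
      by exists (r * t) => //=; rewrite mulr_ge0// ltW.
    by rewrite /step -scalerA -scalerDr mulrBr mulrA lerD2r qZ.
- by rewrite (le_trans (infQ 0 x _))// /step scale0r addr0 mul0r subr0.
- by rewrite (le_trans (infQ 1 x _))// /step scale1r mul1r.
Qed.

(** Zorn's lemma for the reverse pointwise order; a chain below p has its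
pointwise infimum as bound, finite because - p (- x) <= q x for all its q. *)
Lemma minimal_sublinear p : sublinear p ->
  exists q, [/\ sublinear q, forall x, q x <= p x &
    forall q', sublinear q' -> (forall x, q' x <= q x) -> q' = q].
Proof.
move=> sp.
pose T := {q : V -> R | sublinear q /\ forall x, q x <= p x}.
pose mkT q (sq : sublinear q) (qp : forall x, q x <= p x) : T :=
  exist _ q (conj sq qp).
pose below (t u : T) := `[< forall x, sval u x <= sval t x >].
have [t|t u w|t u|A Atot|[q [sq qp]] qmin] := @Zorn T below.
- exact/asboolP.
- by move=> /asboolP tu /asboolP uw; apply/asboolP => x; exact: le_trans (tu x).
- case: t u => [t tP] [u uP] /asboolP /= tu /asboolP /= ut.
  by apply/eq_exist/funext => x; apply/eqP; rewrite eq_le tu ut.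
- have [->|/set0P[t0 At0]] := eqVneq A set0.
    by exists (mkT p sp (fun x => lexx _)).
  pose Q := [set sval t | t in A].
  have lQ q x : Q q -> - p (- x) <= q x.
    move=> [[{}q [/= sq qp]] _ <-]; rewrite (le_trans _ (sublinear_geN x sq))//.
    by rewrite lerN2 qp.
  have infQ t x : A t -> inf [set q x | q in Q] <= sval t x.
    move=> At; apply: ge_inf; last by exists (sval t) => //; exists t.
    by exists (- p (- x)) => _ [q Qq <-]; exact: lQ.
  have sinf : sublinear (fun x => inf [set q x | q in Q]).
    apply: (@inf_sublinear _ (fun x => - p (- x))) => //.
    + by exists (sval t0), t0.
    + move=> _ _ x y [t At <-] [u Au <-].
      have [/asboolP tu|/asboolP ut] := Atot _ _ At Au.
        exists (sval u); first by exists u.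
        by rewrite (le_trans ((svalP u).1.1 x y))// lerD2r tu.
      exists (sval t); first by exists t.
      by rewrite (le_trans ((svalP t).1.1 x y))// lerD2l ut.
    + by move=> _ r x [t At <-] r0; exists (sval t); [exists t|exact: (svalP t).1.2].
  have infp x : inf [set q x | q in Q] <= p x.
    by rewrite (le_trans (infQ t0 x At0))// (svalP t0).2.
  by exists (mkT _ sinf infp) => t At; apply/asboolP => x; exact: infQ.
- exists q; split=> // q' sq' q'q.
  have q'p x : q' x <= p x by exact: le_trans (q'q x) (qp x).
  by have /(congr1 sval) : mkT q' sq' q'p = mkT q sq qp by exact/qmin/asboolP.
Qed.

(** Take f minimal below the functional that [sublinear_descent] attaches to p and
v. For each y the descent of f along y is f itself by minimality, which makes f
superadditive, hence linear. At v, f (- v) <= p (- v + v) - p v = - p v gives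
f v >= p v. *)
Lemma hahn_banach p v : sublinear p ->
  exists f : V -> R, [/\ linear (f : V -> R^o), forall x, f x <= p x & f v = p v].
Proof.
move=> sp; have [pv [spv pvp pvv]] := sublinear_descent v sp.
have [f [sf fpv fmin]] := minimal_sublinear spv.
have fD x y : f (x + y) = f x + f y.
  have [q [sq qf qy]] := sublinear_descent y sf.
  apply/eqP; rewrite eq_le sf.1 /= -lerBrDr -[X in X x](fmin q sq qf); exact: qy.
have fN x : f (- x) = - f x.
  by apply/eqP; rewrite -addr_eq0 addrC -fD subrr sublinear0.
have fp x : f x <= p x by exact: le_trans (fpv x) (pvp x).
exists f; split=> // [r x y|]; last first.
  apply/eqP; rewrite eq_le fp /= -lerN2 -fN (le_trans (fpv _))//.
  by rewrite (le_trans (pvv _))// addNr sublinear0// sub0r.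
rewrite fD; congr (_ + _); have [r0|r0|->] := ltgtP r 0.
- rewrite -[r]opprK scaleNr fN sublinearZ ?oppr_gt0//.
  by rewrite -[RHS]/(- - r * f x) mulNr.
- exact: sublinearZ.
- by rewrite !scale0r sublinear0.
Qed.

End hahn_banach.

(** * Norming functionals over real or complex scalars *)

(** An alias of E, so that the real vector space structure does not compete with
the given one. *)
Definition real_restriction (R : realType) (s : scalar_kind)
  (E : lmodType (scalar_field R s)) : Type := E.

Section real_restriction.
Context {R : realType} {s : scalar_kind} {E : lmodType (scalar_field R s)}.

HB.instance Definition _ := GRing.Zmodule.copy (real_restriction E) E.

Let scale (r : R) (x : real_restriction E) : real_restriction E :=
  (of_real r : scalar_field R s) *: (x : E).

Let scaleA a b x : scale a (scale b x) = scale (a * b) x.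
Proof. by rewrite /scale scalerA of_realM. Qed.

Let scale1 x : scale 1 x = x.
Proof. by rewrite /scale of_real1 scale1r. Qed.

Let scaleDr a : {morph scale a : x y / x + y}.
Proof. exact: scalerDr. Qed.

Let scaleDl x : {morph scale^~ x : a b / a + b}.
Proof. by move=> a b; rewrite /scale of_realD scalerDl. Qed.

HB.instance Definition _ := GRing.Zmodule_isLmodule.Build R (real_restriction E)
  scaleA scale1 scaleDr scaleDl.

End real_restriction.

Section norming.
Context {R : realType} {s : scalar_kind}.
Local Notation K := (scalar_field R s).

Lemma real_norming_functional (E : normedModType K) (e : E) : exists f : E -> R,
  [/\ forall x y, f (x + y) = f x + f y,
      forall r x, f ((of_real r : K) *: x) = r * f x,
      forall x, f x <= to_real `|x| & f e = to_real `|e|].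
Proof.
have to_realM (r : R) (x : K) : 0 < r -> 0 <= x ->
    to_real (of_real r * x) = r * to_real x.
  by move=> r0 x0; rewrite -{1}(to_realK x0) -of_realM of_realK.
have sn : sublinear (fun x : real_restriction E => to_real `|x : E|).
  split=> [x y|r x r0].
    rewrite -[leRHS](@of_realK R s) of_realD !to_realK//.
    by apply: ler_to_real => //; exact: ler_normD.
  rewrite -[r *: x]/((of_real r : K) *: (x : E)) normrZ norm_of_real gtr0_norm//.
  by rewrite to_realM.
have [f [flin fn fe]] := hahn_banach (e : real_restriction E) sn; exists f; split=> //.
- by move=> x y; have := flin 1 x y; rewrite !scale1r.
- move=> r x; have f0 : f 0 = 0.
    by have := flin (-1) 0 0; rewrite scaler0 addr0 scaleN1r addNr.
  by have := flin r x 0; rewrite f0 !addr0.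
Qed.

End norming.

(** In the complex case f is the real part of phi x = f x - i f (i x). For c of
modulus 1 with phi (c x) = |phi x|, this number is f (c x), hence at most |x|. *)
Lemma norming_linear (R : realType) (s : scalar_kind)
    (E : normedModType (scalar_field R s)) (e : E) :
  exists phi : E -> (scalar_field R s)^o,
   [/\ linear phi, forall x, `|phi x| <= `|x| & `|phi e| = `|e|].
Proof.
have [f [fD fZ fn fe]] := real_norming_functional e.
case: s E e f fD fZ fn fe => /= E e f fD fZ fn fe.
  have fN x : f (- x) = - f x by rewrite -scaleN1r fZ mulN1r.
  have fle x : `|f x| <= `|x|.
    by rewrite ler_norml fn andbT lerNl -fN -normrN fn.
  exists f; split=> // [k x y|]; first by rewrite fD fZ.
  by rewrite fe [LHS]normr_id.
have normReK (F : normedModType R[i]) (x : F) : ((complex.Re `|x|)%:C)%C = `|x|.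
  exact: (@to_realK R complex_scalars).
pose phi x : R[i] := Complex (f x) (- f ('i%C *: x)).
have fZC (a b : R) x : f (Complex a b *: x) = a * f x + b * f ('i%C *: x).
  rewrite -!fZ -fD scalerA -scalerDl; congr (f (_ *: x)).
  by apply/eqP; rewrite eq_complex /=; apply/andP; split; apply/eqP; ring.
have philin : linear (phi : E -> (R[i])^o).
  move=> [a b] x y; rewrite /phi fD scalerDr fD scalerA.
  have -> : 'i%C * Complex a b = Complex (- b) a.
    by apply/eqP; rewrite eq_complex /=; apply/andP; split; apply/eqP; ring.
  rewrite (fZC a b) (fZC (- b) a).
  by apply/eqP; rewrite eq_complex /=; apply/andP; split; apply/eqP; ring.
have phi0 : phi 0 = 0.
  have := philin (-1) 0 0; rewrite scaler0 addr0 scaleN1r addNr; exact.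
have phiZ k x : phi (k *: x) = k * phi x.
  by have := philin k x 0; rewrite phi0 !addr0.
have phin x : `|phi x| <= `|x|.
  have [->|z0] := eqVneq (phi x) 0; first by rewrite normr0.
  pose c := `|phi x| / phi x.
  have c1 : `|c| = 1 by rewrite normrM normrV ?unitfE// normr_id divff ?normr_eq0.
  have phic : phi (c *: x) = `|phi x| by rewrite phiZ divfK.
  have := fn (c *: x); rewrite normrZ c1 mul1r.
  by rewrite -[f _]/(complex.Re (phi (c *: x))) phic -lecR !normReK.
exists phi; split => //; apply/eqP; rewrite eq_le phin /=.
apply: le_trans (normc_ge_Re _); rewrite -[complex.Re _]/(f e) fe.
have e0 : 0 <= complex.Re `|e| by rewrite -lecR normReK; exact: normr_ge0.
by rewrite (ger0_norm e0) normReK.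
Qed.

Lemma linear_bounded_blin (R : realType) (s : scalar_kind)
    (E F : normedModType (scalar_field R s)) (f : E -> F) (M : scalar_field R s) :
  linear f -> 0 <= M -> (forall x, `|f x| <= M * `|x|) -> f \in blin_pred.
Proof.
move=> lf M0 fM; rewrite inE; split=> //.
pose lin := GRing.isLinear.Build _ _ _ _ f lf.
pose fL : {linear E -> F} := HB.pack f lin.
apply: (@bounded_linear_continuous _ _ _ fL); apply/linear_boundedP.
exists M; split; first exact: ger0_real.
by move=> r /ltW Mr x; rewrite (le_trans (fM x))// ler_wpM2r.
Qed.

Lemma norming_functional (R : realType) (s : scalar_kind)
    (E : normedModType (scalar_field R s)) (e : E) :
  exists2 phi : topdual E, `|phi| <= 1 & `|phi e| = `|e|.
Proof.
have [phi [lphi phin phie]] := norming_linear e.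
have phiP : phi \in blin_pred.
  by apply: (linear_bounded_blin lphi ler01) => x; rewrite mul1r.
exists (BLin phi phiP) => //; apply: blin_norm_le => x x1.
exact: le_trans (phin x) x1.
Qed.

Lemma topdual_separates (R : realType) (s : scalar_kind)
    (E : normedModType (scalar_field R s)) (x y : E) :
  (forall phi : topdual E, phi x = phi y) -> x = y.
Proof.
move=> xy; apply/eqP; rewrite -subr_eq0 -normr_eq0.
have [phi _ <-] := norming_functional (x - y).
by rewrite linearB /= xy subrr normr0.
Qed.

(** * Isometries with a common domain *)

Section matched.
Context {K : numFieldType} {V W Z : normedModType K}.
Context (i : {linear V -> W}) (j : {linear V -> Z}).
Context (ni : forall v, `|i v| = `|v|) (nj : forall v, `|j v| = `|v|).

Definition common_limit (w : W) (z : Z) :=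
  exists2 F : set_system V, ProperFilter F & i @ F --> w /\ j @ F --> z.

(** When w is in the closure of the range of i, this amounts to [common_limit]; but
an equation between norms is easier to carry through sums and limits. *)
Definition equidistant (w : W) (z : Z) := forall v, `|w - i v| = `|z - j v|.

Lemma equidistant0 : equidistant 0 0.
Proof. by move=> v; rewrite !sub0r !normrN ni nj. Qed.

(** For w = i u and z = j u the claim is the hypothesis at v - k u, by linearity of
i and j; then u runs along the filter that defines w and z. *)
Lemma common_limit_equidistant k w z w' z' : common_limit w z ->
  equidistant w' z' -> equidistant (k *: w + w') (k *: z + z').
Proof.
move=> [F FF [iw jz]] eqwz v.
have lw : (fun u => `|k *: i u + w' - i v|) @ F --> `|k *: w + w' - i v|.
  apply: cvg_norm; apply: cvgB (cvg_cst _); apply: cvgD (cvg_cst _).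
  by apply: cvgZ => //; exact: cvg_cst.
have lz : (fun u => `|k *: j u + z' - j v|) @ F --> `|k *: z + z' - j v|.
  apply: cvg_norm; apply: cvgB (cvg_cst _); apply: cvgD (cvg_cst _).
  by apply: cvgZ => //; exact: cvg_cst.
have eqF : (fun u => `|k *: i u + w' - i v|) =
           (fun u => `|k *: j u + z' - j v|).
  apply/funext => u; have := eqwz (v - k *: u).
  rewrite (linearB i) (linearB j) !opprB !linearZZ !addrA.
  by rewrite (addrC w') (addrC z').
by rewrite eqF in lw; apply: cvg_unique lw lz; exact: norm_hausdorff.
Qed.

(** Along the filter, j v is as far from z' as i v is from w, so it converges to z'
as well as to z. *)
Lemma common_limit_unique w z z' : common_limit w z -> equidistant w z' -> z = z'.
Proof.
move=> [F FF [iw jz]] eqwz; apply: (cvg_unique _ jz); first exact: norm_hausdorff.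
apply/cvgrPdist_lt => e e0; near=> v; rewrite -eqwz.
by near: v; apply: cvgr_dist_lt iw _ e0.
Unshelve. all: by end_near. Qed.

Lemma common_limit_closure w z : common_limit w z -> closure (range j) z.
Proof.
move=> [F FF [_ jz]]; rewrite closureEcvg; exists (j @ F).
  exact: fmap_proper_filter.
split=> //.
move=> A rA; rewrite -[_ A]/(F (j @^-1` A)); apply: filterS filterT => v _.
by apply: rA; exists v.
Qed.

(** The traces on V of the neighbourhoods of w form a filter whose image under i is
Cauchy; its image under j is then Cauchy too, since i and j distort no distance. *)
Lemma common_limit_exists w :
  (forall F : set_system Z, ProperFilter F -> cauchy F -> cvg F) ->
  closure (range i) w -> exists z, common_limit w z.
Proof.
move=> Zcomplete wi.
pose F := filter_from (nbhs w) (fun B => i @^-1` B).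
have FF : ProperFilter F.
  apply: filter_from_proper; last first.
    by move=> B /wi[_ [[v _ <-] Bv]]; exists v.
  apply: filter_from_filter; first by exists setT; exact: filterT.
  by move=> A B wA wB; exists (A `&` B) => //; exact: filterI.
have iw : i @ F --> w by move=> A wA; exists A.
have /Zcomplete : cauchy (j @ F).
  have /cvg_cauchy/cauchy_ballP ci : cvg (i @ F) by apply/cvg_ex; exists w.
  have Fj A : F (i @^-1` A) -> F (j @^-1` (j @` (i @^-1` A))).
    by apply: filterS => v Av; exists v.
  apply/cauchy_ballP => e e0; have [[A B] [/= FA FB] AB] := ci e e0.
  exists (j @` (i @^-1` A), j @` (i @^-1` B)) => /=.
    by split; exact: Fj.
  move=> [_ _] /= [[u Au <-] [v Bv <-]]; have := AB (i u, i v) (conj Au Bv).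
  by rewrite -!ball_normE /= -!linearB ni nj.
by move=> /cvg_ex[z jz]; exists z; exists F.
Qed.

End matched.

Lemma common_limitC (K : numFieldType) (V W Z : normedModType K)
    (i : {linear V -> W}) (j : {linear V -> Z}) w z :
  common_limit i j w z -> common_limit j i z w.
Proof. by move=> [F FF []]; exists F. Qed.

(** Phi sends w to the z with which it forms a common limit. Every z in the closure
is reached because the construction is symmetric in i and j. *)
Lemma closure_isometric_isomorphism (K : numFieldType) (V : normedModType K)
    (W Z : completeNormedModType K) (i : V -> W) (j : V -> Z) :
  is_completion i -> linear j -> (forall v, `|j v| = `|v|) ->
  exists Phi : W -> Z, isometric_isomorphism (closure (range j)) Phi.
Proof.
move=> [il ni di] jl nj.
pose iL : {linear V -> W} := HB.pack i (GRing.isLinear.Build _ _ _ _ i il).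
pose jL : {linear V -> Z} := HB.pack j (GRing.isLinear.Build _ _ _ _ j jl).
have /choice[Phi PhiP] w : exists z, common_limit iL jL w z.
  apply: (common_limit_exists (i := iL) (j := jL) ni nj); first exact: cauchy_cvg.
  move=> B; rewrite nbhsE => -[O [oO Ow] OB].
  have [x [Ox ix]] := di O (ex_intro _ w Ow) oO.
  by exists x; split=> //; exact: OB.
have eqPhi w : equidistant iL jL w (Phi w).
  have := common_limit_equidistant 1 (PhiP w) (equidistant0 (i := iL) (j := jL) ni nj).
  by rewrite !scale1r !addr0.
have Phil : linear Phi.
  move=> k w w'; apply: common_limit_unique (PhiP _) _.
  exact: common_limit_equidistant.
have nPhi w : `|Phi w| = `|w|.
  by have := eqPhi w 0; rewrite (raddf0 iL) (raddf0 jL) !subr0 => ->.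
exists Phi; split=> //; split=> [w _|w w' _ _ eqw|z jz].
- exact: common_limit_closure (PhiP w).
- apply/eqP; rewrite -subr_eq0 -normr_eq0 -nPhi.
  have -> : w - w' = (-1) *: w' + w by rewrite scaleN1r addrC.
  by rewrite Phil eqw scaleN1r addNr normr0.
- have [w zw] := common_limit_exists (i := jL) (j := iL) nj ni (@cauchy_cvg W) jz.
  exists w => //; apply/esym; exact: common_limit_unique (common_limitC zw) (eqPhi w).
Qed.

(** * Completeness of the space of bounded operators *)

Section blin_complete.
Context {R : realType} {s : scalar_kind}.
Local Notation K := (scalar_field R s).
Context {E : normedModType K} {F : completeNormedModType K}.

(** The limit L is taken pointwise. If a ball of radius e around S contains a large
set of the filter, then |L x - S x| <= e |x| for all x: for e = 1 this shows that
L is bounded, for small e that L is the limit in norm. *)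
Lemma blin_complete (G : set_system (blin E F)) :
  ProperFilter G -> cauchy G -> cvg G.
Proof.
move=> GG cauchyG; have /cauchy_ballP cG := cauchyG.
have /choice[L GL] (x : E) : exists y : F, (fun S : blin E F => S x) @ G --> y.
  apply/cvg_ex; apply: cauchy_cvg; apply/cauchy_ballP => e e0.
  (* |x| may be 0, so the radius is divided by |x| + 1 *)
  have x1 : 0 < `|x| + 1 by rewrite ltr_wpDl.
  pose ev (S : blin E F) := S x.
  have Gev A : G A -> G (ev @^-1` (ev @` A)).
    by apply: filterS => S AS; exists S.
  have [[A B] [/= GA GB] AB] := cG (e / (`|x| + 1)) (divr_gt0 e0 x1).
  exists (ev @` A, ev @` B) => /=.
    by split; exact: Gev.
  move=> [_ _] /= [[S AS <-] [T BT <-]]; have := AB (S, T) (conj AS BT).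
  rewrite -!ball_normE /= ltr_pdivlMr// => /le_lt_trans; apply.
  rewrite -[ev S - ev T]/((S - T) x); apply: le_trans (ler_blin_norm _ _) _.
  by rewrite ler_wpM2l ?lerDl// blin_norm_ge0.
have Ll : linear L.
  move=> k x y; apply: (cvg_unique _ (GL _)); first exact: norm_hausdorff.
  rewrite (_ : (fun S : blin E F => S _) = (fun S => k *: S x + S y)).
    by apply: cvgD => //; apply: cvgZ => //; exact: cvg_cst.
  by apply/funext => S; rewrite linearP.
have close_lim e S : G (ball S e) -> forall x, `|L x - S x| <= e * `|x|.
  move=> Se x; apply/ler_addgt0Pr => d d0.
  near G => T.
  rewrite -(subrK (T x) (L x)) -addrA (le_trans (ler_normD _ _))//.
  rewrite [leRHS]addrC lerD//; first by near: T; exact: cvgr_dist_le (GL x) _ d0.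
  rewrite -[T x - S x]/((T - S) x); apply: le_trans (ler_blin_norm _ _) _.
  rewrite ler_wpM2r// -blin_normE distrC.
  have : ball S e T by near: T.
  by rewrite -ball_normE /= => /ltW.
have [S0 S01] := (cauchyP G).1 cauchyG 1 ltr01.
have LP : L \in blin_pred.
  apply: (@linear_bounded_blin _ _ _ _ _ (1 + blin_norm S0) Ll) => [|x].
    by rewrite addr_ge0// blin_norm_ge0.
  rewrite -(subrK (S0 x) (L x)) (le_trans (ler_normD _ _))// mulrDl lerD//.
    exact: close_lim.
  exact: ler_blin_norm.
apply/cvg_ex; exists (BLin L LP); apply/cvgrPdist_le => e e0.
have [[A B] [/= GA GB] AB] := cG e e0.
apply: filterS GA => S AS; apply: blin_norm_le => x x1.
rewrite -[X in `|X|]/(L x - S x) (le_trans (close_lim e S _ x))//.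
  by apply: filterS GB => T BT; exact: (AB (S, T)).
by rewrite ler_piMr// ltW.
Unshelve. all: by end_near. Qed.

HB.instance Definition _ := Uniform_isComplete.Build (blin E F) blin_complete.

End blin_complete.

(** * Operators continuous for pointwise convergence *)

Lemma cvg_sum (K : numFieldType) (V : normedModType K) (T I : Type)
    (F : set_system T) (r : seq I) (f : I -> T -> V) (a : I -> V) : Filter F ->
  (forall i, f i @ F --> a i) ->
  (fun t => \sum_(i <- r) f i t) @ F --> \sum_(i <- r) a i.
Proof.
move=> FF fa; elim: r => [|i r IHr].
  by under eq_cvg do rewrite big_nil; rewrite big_nil; exact: cvg_cst.
by under eq_cvg do rewrite big_cons; rewrite big_cons; exact: cvgD.
Qed.

Section ptws.
Context {R : realType} {s : scalar_kind} {X : metricType R} {x0 : X}.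
Local Notation K := (scalar_field R s).
Local Notation Xdual := (lipdual s x0).
Local Notation Xptws := (@lipdual_ptws R s X x0).

Lemma ptws_cvgP (F : set_system Xdual) (g : Xdual) : Filter F ->
  F --> (g : Xptws) <-> forall x, (fun h : Xdual => h x : K^o) @ F --> (g x : K^o).
Proof.
move=> FF; pose ev (h : Xdual) : {ptws X -> K^o} := lip0_fun h.
have evP : ev @ F --> (ev g) <->
    forall x, (fun h : Xdual => h x : K^o) @ F --> (g x : K^o).
  exact: (@pointwise_cvgP _ _ (ev @ F) (ev g)).
apply: iff_trans evP; split=> [Fg|evF].
  by apply: cvg_comp Fg _; exact: (@initial_continuous _ _ ev).
move=> A [_ [[B oB <-] Bg] BA]; apply: filterS BA _.
by apply: evF; exact: open_nbhs_nbhs.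
Qed.

(** Continuity at 0, tested along the functions vanishing on larger and larger
finite sets, yields a finite set A such that S h only depends on the values of h
on A; then g is interpolated on A by functions supported at one point of A. The
base point needs no interpolation, since g x0 = 0. *)
Lemma ptws_continuous_expansion (E : normedModType K) (S : blin Xdual E) :
  continuous (S : Xptws -> E) ->
  exists n (p : 'I_n -> X) (b : 'I_n -> Xdual),
    forall g, S g = \sum_(i < n) g (p i) *: S (b i).
Proof.
move=> cS.
pose vanish (A : seq X) := [set h : Xdual | forall x, x \in A -> h x = 0].
pose F := filter_from [set: seq X] vanish.
have FF : Filter F.
  apply: filter_from_filter; first by exists [::].
  move=> A B _ _; exists (A ++ B) => // h hAB.
  by split=> x xA; apply: hAB; rewrite mem_cat xA ?orbT.
have F0 : F --> (0 : Xptws).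
  apply/ptws_cvgP => x; apply: cvg_near_cst.
  by exists [:: x] => // h; apply; rewrite inE.
have SF : S @ F --> (0 : E).
  rewrite -(linear0 S) => A /(cS 0); exact: F0.
have [A _ SA] : F [set h | `|S h| < 1].
  exact: ((cvgr0Pnorm_lt _).1 SF 1 ltr01).
have S0 h : vanish A h -> S h = 0.
  move=> hA; apply/eqP/negPn/negP => Sh0.
  have /SA : vanish A (`|S h|^-1 *: h).
    by move=> x xA; rewrite lip0Z hA// scaler0.
  by rewrite /= linearZ normfZV// ltxx.
have /choice[b bP] p : exists g : Xdual, p != x0 ->
    g p = 1 /\ forall q, q \in A -> q != p -> g q = 0.
  have [->|px0] := eqVneq p x0; first by exists 0.
  by have [g gp gS] := @lipdual_separates R s X x0 p A px0; exists g.
pose A' := [seq p <- undup A | p != x0].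
exists (size A'), (tnth (in_tuple A')), (fun i => b (tnth (in_tuple A') i)) => g.
pose h := g - \sum_(p <- A') g p *: b p.
rewrite -(big_tnth _ _ A' xpredT (fun p => g p *: S (b p))).
have /S0 : vanish A h.
  move=> q qA; have -> : h q = g q - \sum_(p <- A') g p * b p q.
    by rewrite -[LHS]/(g q - (\sum_(p <- A') g p *: b p) q) lip0_sum.
  have [->|qx0] := eqVneq q x0.
    by rewrite lip0_base big1 ?subr0// => p _; rewrite lip0_base mulr0.
  have qA' : q \in A' by rewrite mem_filter qx0 mem_undup.
  rewrite (bigD1_seq q) ?filter_uniq ?undup_uniq//= (bP q qx0).1 mulr1.
  rewrite big_seq_cond big1 ?addr0 ?subrr// => p /andP[pA' pq].
  have px0 : p != x0 by move: pA'; rewrite mem_filter => /andP[].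
  by rewrite (bP p px0).2 ?mulr0// eq_sym.
rewrite linearB linear_sum /= => /eqP; rewrite subr_eq0 => /eqP ->.
by apply: eq_bigr => p _; rewrite linearZ.
Qed.

Lemma ptws_continuous_finite_rank (E : normedModType K) (S : blin Xdual E) :
  continuous (S : Xptws -> E) -> finite_rank_ptws x0 E S.
Proof.
move=> cS; split=> //.
have [n [p [b SE]]] := ptws_continuous_expansion cS.
exists n, (S \o b); apply/seteqP; split=> [_ [g _ <-]|_ [m [c [a [ab ->]]]]].
  by exists n, (g \o p), (S \o b); split=> // i; exists i.
have /choice[k kP] i : exists k, S (b k) = a i by have [k _ <-] := ab i; exists k.
exists (\sum_(i < m) c i *: b (k i)) => //.
by rewrite linear_sum; apply: eq_bigr => i _; rewrite linearZ /= kP.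
Qed.

End ptws.

(** * The operator of a tensor *)

Section tensor_operator.
Context {R : realType} {s : scalar_kind} {X : metricType R} {x0 : X}.
Local Notation K := (scalar_field R s).
Context {E : normedModType K}.
Local Notation Xdual := (lipdual s x0).
Local Notation Xptws := (@lipdual_ptws R s X x0).

(** A description of S = J(u) that does not involve a representation of u as a sum
of elementary tensors. *)
Definition represents (u : lip_tensor x0 E) (S : blin Xdual E) :=
  forall g (phi : topdual E), phi (S g) = u (lip_smul g phi).

Lemma represents_sumE n (x y : 'I_n -> X) (e : 'I_n -> E) (S : blin Xdual E) :
  represents (\sum_(i < n) boxtimes (x i) (y i) (e i)) S <->
  forall g, S g = \sum_(i < n) (g (x i) - g (y i)) *: e i.
Proof.
have phiE (g : Xdual) (phi : topdual E) :
    phi (\sum_(i < n) (g (x i) - g (y i)) *: e i) =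
    (\sum_(i < n) boxtimes (x i) (y i) (e i) : lip_tensor x0 E) (lip_smul g phi).
  rewrite linear_sum boxtimes_sum_lip_smul; apply: eq_bigr => i _.
  by rewrite linearZ.
split=> [uS g|SE g phi]; last by rewrite SE phiE.
by apply: topdual_separates => phi; rewrite uS phiE.
Qed.

Lemma represents_uniq u S T : represents u S -> represents u T -> S = T.
Proof.
move=> uS uT; apply/val_inj/funext => g.
by apply: topdual_separates => phi; rewrite uS uT.
Qed.

Lemma represents_linear k u v S T : represents u S -> represents v T ->
  represents (k *: u + v) (k *: S + T).
Proof.
move=> uS vT g phi.
by rewrite blinD blinZ linearP /= uS vT.
Qed.

(** Both norms are the supremum of |phi (S g)| = |u (lip_smul g phi)| over g and phi
of norm at most 1; for |S|, because each vector S g is normed by some phi. *)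
Lemma represents_norm u S : represents u S -> `|S| = `|u|.
Proof.
move=> uS; apply/eqP; rewrite eq_le; apply/andP; split.
  apply: blin_norm_le => g g1; have [phi phi1 <-] := norming_functional (S g).
  by rewrite uS inj_norm_ub.
apply: inj_norm_le => g phi g1 phi1; rewrite -uS.
apply: le_trans (ler_blin_norm _ _) _.
by rewrite (le_trans (ler_piMl _ phi1))// blin_norm_ub.
Qed.

Lemma sum_eval_ptws_continuous n (x y : 'I_n -> X) (e : 'I_n -> E) :
  continuous (fun g : Xptws => \sum_(i < n) (g (x i) - g (y i)) *: e i : E).
Proof.
move=> g; have FF : Filter (nbhs (g : Xptws)) by exact: nbhs_filter.
have /ptws_cvgP gP : nbhs (g : Xptws) --> (g : Xptws) by exact: cvg_id.
apply: (@cvg_sum _ _ _ _ (nbhs (g : Xptws)) _ _ _ FF) => i.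
apply: (@cvgZ _ _ _ (nbhs (g : Xptws)) FF); last exact: cvg_cst.
by apply: (@cvgB _ _ _ (nbhs (g : Xptws)) FF); exact: gP.
Qed.

Lemma represents_exists u :
  exists2 S : blin Xdual E, represents u S & finite_rank_ptws x0 E S.
Proof.
have [n [x [y [e ->]]]] := lip_tensor_repr u.
pose f (g : Xdual) := \sum_(i < n) (g (x i) - g (y i)) *: e i : E.
have cf : continuous (f : Xptws -> E) by exact: sum_eval_ptws_continuous.
have fP : f \in blin_pred.
  rewrite inE; split; last exact: continuous_ptwsW.
  move=> k g h; rewrite /f scaler_sumr -big_split; apply: eq_bigr => i _ /=.
  rewrite scalerA -scalerDl; congr (_ *: _).
  rewrite -[LHS]/(k * g (x i) + h (x i) - (k * g (y i) + h (y i))).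
  by rewrite opprD addrACA mulrBr.
exists (BLin f fP); first exact/represents_sumE.
exact: ptws_continuous_finite_rank.
Qed.

Lemma represents_surj S : finite_rank_ptws x0 E S -> exists u, represents u S.
Proof.
move=> [_ /ptws_continuous_expansion[n [p [b SE]]]].
exists (\sum_(i < n) boxtimes (p i) x0 (S (b i))); apply/represents_sumE => g.
by rewrite SE; apply: eq_bigr => i _; rewrite lip0_base subr0.
Qed.

End tensor_operator.

Theorem proposition5p5 (R : realType) (s : scalar_kind) (X : metricType R)
    (x0 : X) (E : completeNormedModType (scalar_field R s)) :
  (exists J : lip_tensor x0 E -> blin (lipdual s x0) E,
    (forall n (x y : 'I_n -> X) (e : 'I_n -> E) (g : lipdual s x0),
      J (\sum_(i < n) boxtimes (x i) (y i) (e i)) g =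
      \sum_(i < n) (g (x i) - g (y i)) *: e i) /\
    isometric_isomorphism (finite_rank_ptws x0 E) J) /\
  (forall (W : completeNormedModType (scalar_field R s))
      (i : lip_tensor x0 E -> W), is_completion i ->
    exists Phi : W -> blin (lipdual s x0) E,
      isometric_isomorphism (closure (finite_rank_ptws x0 E)) Phi).
Proof.
have /choice[J JP] (u : lip_tensor x0 E) : exists S : blin (lipdual s x0) E,
    represents u S /\ finite_rank_ptws x0 E S.
  by have [S] := represents_exists u; exists S.
have Jrep u : represents u (J u) by have [] := JP u.
have Jlin : linear J.
  by move=> k u v; apply: represents_uniq (Jrep _) _; exact: represents_linear.
have Jnorm u : `|J u| = `|u| by exact: represents_norm.
have Jsurj S : finite_rank_ptws x0 E S -> exists u, J u = S.
  by move=> /represents_surj[u uS]; exists u; exact: represents_uniq uS.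
split; last first.
  move=> W i iW.
  have [Phi] := closure_isometric_isomorphism iW Jlin Jnorm.
  suff -> : range J = finite_rank_ptws x0 E by exists Phi.
  apply/seteqP; split=> [_ [u _ <-]|S /Jsurj[u <-]]; last by exists u.
  by have [] := JP u.
exists J; split=> [n x y e g|]; first exact: (iffLR (represents_sumE _ _ _ _)).
split=> //; split=> [u _|u v _ _ Juv|S /Jsurj[u <-]]; last by exists u.
  by have [] := JP u.
apply/eqP; rewrite -subr_eq0 -normr_eq0 -Jnorm.
have -> : u - v = (-1) *: v + u by rewrite scaleN1r addrC.
by rewrite Jlin Juv scaleN1r addNr normr0.
Qed.
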